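(* Let $N\in\mathbb{N}$ and $\beta\in\mathcal{B}_N$, and let $\Gamma$ be the attractor of the self-similar IFS $\{\phi_i(x)=\beta x+i\frac{1-\beta}{N}:i=0,1,\ldots,N\}$. For $t>0$, the union $\Gamma\cup(\Gamma+t)$ is a self-similar set if and only if $$t=\frac{i(1-\beta)}{N}\beta^{-k}$$ for some $i\in\{1,2,\ldots,\lfloor\frac{N+1}{2}\rfloor\}$ and $k\in\mathbb{N}$.
   Context: $\mathbb{N}=\{1,2,\ldots\}$ and $\lfloor x\rfloor$ is the integer part of $x$. A self-similar IFS on $\mathbb{R}$ is a finite set of maps $f_i(x)=\lambda_i x+a_i$ with $0<|\lambda_i|<1$, $a_i\in\mathbb{R}$; its attractor is the unique non-empty compact set $K\subset\mathbb{R}$ with $K=\bigcup_i f_i(K)$. A self-similar set is the attractor of some self-similar IFS; self-similar sets are always assumed to be non-singletons. $\mathcal{B}_N$ denotes the set of $0<\beta<1/(N+1)$ such that for any $n\in\mathbb{N}$, any $i_1,\ldots,i_n\in\{0,1,\ldots,2N\}$ and any $j_1,\ldots,j_n\in\{0,1,\ldots,N\}$, the equality $\sum_{k=1}^n i_k\beta^k=\sum_{k=1}^n j_k\beta^k$ implies $i_k=j_k$ for all $1\le k\le n$. *)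

(* Defs.v *)
From HB Require Import structures.
From mathcomp Require Import all_boot all_order all_algebra.
From mathcomp Require Import all_classical all_reals all_analysis.

Set Implicit Arguments.
Unset Strict Implicit.
Unset Printing Implicit Defensive.

Import Order.TTheory GRing.Theory Num.Theory.
Import numFieldNormedType.Exports.

Local Open Scope classical_set_scope.
Local Open Scope ring_scope.

Definition contracting_similarity (R : realType) (f : R -> R) : Prop :=
  exists lambda a : R, 0 < `|lambda| < 1 /\ f = (fun x => lambda * x + a).

Definition self_similar_IFS (R : realType) (F : set (R -> R)) : Prop :=
  finite_set F /\ (forall f, F f -> contracting_similarity f).

Definition is_attractor (R : realType) (F : set (R -> R)) (K : set R) : Prop :=
  [/\ K !=set0, compact K & K = \bigcup_(f in F) (f @` K)].

(* Self-similar sets are by convention not singletons. *)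
Definition self_similar_set (R : realType) (K : set R) : Prop :=
  (exists F : set (R -> R), self_similar_IFS F /\ is_attractor F K) /\
  ~ (exists x : R, K = [set x]).

(* The digit of index k : 'I_n (0-based) is the coefficient of beta ^ (k + 1). *)
Definition calB (R : realType) (N : nat) : set R :=
  [set beta | 0 < beta < 1 / N.+1%:R /\
    forall (n : nat) (i : 'I_n -> 'I_(2 * N).+1) (j : 'I_n -> 'I_N.+1),
      (0 < n)%N ->
      \sum_(k < n) (i k)%:R * beta ^+ k.+1 =
        \sum_(k < n) (j k)%:R * beta ^+ k.+1 ->
      forall k : 'I_n, i k = j k :> nat].

Definition phi (R : realType) (N : nat) (beta : R) (i : nat) : R -> R :=
  fun x => beta * x + i%:R * ((1 - beta) / N%:R).

Definition phi_IFS (R : realType) (N : nat) (beta : R) : set (R -> R) :=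
  [set phi N beta i | i in [set i : nat | (i <= N)%N]].

Definition translate (R : realType) (A : set R) (t : R) : set R :=
  [set x + t | x in A].

(* Main.v *)
Require Import Defs.
From mathcomp Require Import all_boot all_order all_algebra.
From mathcomp Require Import all_classical all_reals all_analysis.
From mathcomp Require Import ring lra zify.

Import Order.TTheory GRing.Theory Num.Theory.
Import numFieldNormedType.Exports.

Local Open Scope classical_set_scope.
Local Open Scope ring_scope.

(** Points of Gamma are the sums of (1 - beta) / N * j_l * beta ^ l with digits
j_l in {0, .., N}; finite words of digits index the cylinders of Gamma, which
are separated because beta < step = (1 - beta) / N.

If t = i * step / beta ^ k with 2 * i <= N + 1, then beta ^ k * t shifts one
digit by i. The digits {0, .., N} are covered by pairs {j, j + i}, so Gamma and
Gamma + t are both unions of copies of the union A = Gamma + {0, t} scaled by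
beta ^ k (union_self_similar).

Conversely, let A be self-similar. By symmetry of A all maps may be taken
orientation-preserving, and by iteration as contracting as needed
(self_similar_covers, covers_small). Any cylinder of Gamma is covered by the
images of A, so by Baire one of the images of Gamma contains a smaller
cylinder; if this image lies in Gamma, its gaps are those of Gamma there, and
as all gaps of Gamma have lengths gap * beta ^ n the ratio of the map is a power
beta ^ m (ratio_is_power). Moreover a copy of Gamma inside Gamma cannot jump
across a gap longer than its own, so a copy of ratio beta ^ m is a cylinder of
level m (copy_is_cylinder). Hence small copies of A inside Gamma are pairs of
cylinders u, u' with u' = u + beta ^ m * t (cover_gives_cylinder_pair).

Applied near 0 this shows that t is a finite word v of digits divided by
beta ^ (size v); in particular t > 1, so Gamma and Gamma + t are disjoint.
Applied to an arbitrary long word w, it says that w starts with some u or u'; by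
the condition defining calB, u' is the digitwise sum of u and of a shift of v
(words_compare_with_t). Choosing w to be made of alternating blocks of 0 and N
forces v to have a single non-zero digit i, and the constant word i - 1 then
gives 2 * i <= N + 1 (single_nonzero_digit). *)

(** * Topological preliminaries *)

Lemma exists_expr_lt (R : realType) (x e : R) :
  0 <= x < 1 -> 0 < e -> exists n, x ^+ n < e.
Proof.
move=> /andP[x0 x1] e0.
have /cvgr0_norm_lt/(_ e e0) : x ^+ n @[n --> \oo] --> 0.
  by apply: cvg_expr; rewrite ger0_norm.
case=> n _ /(_ n (leqnn n)) /= xn; exists n.
exact: le_lt_trans (ler_norm _) xn.
Qed.

Lemma closed_avoids_ball (R : realType) (F : set R) x : closed F -> ~ F x ->
  exists2 e : R, 0 < e & forall y, `|y - x| < e -> ~ F y.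
Proof.
move=> /closed_openC oF Fx.
have /nbhs_ballP[e /= e0 He] : nbhs x (~` F) by exact: open_nbhs_nbhs.
exists e => // y yx; apply: He; rewrite /ball /=.
by rewrite distrC.
Qed.

Lemma closed_geometric_approx (R : realType) (F : set R) (x b C : R) :
  0 <= b < 1 -> closed F ->
  (forall n, exists2 y, F y & `|y - x| <= b ^+ n * C) -> F x.
Proof.
move=> b01 cF H; apply: contrapT => Fx.
have [e e0 He] := closed_avoids_ball _ _ x cF Fx.
have C0 : 0 <= C.
  have [y _] := H 0%N; rewrite expr0 mul1r; exact: le_trans.
have eC : 0 < e / (C + 1) by rewrite divr_gt0 // ltr_pwDr.
have [n bn] := exists_expr_lt _ _ _ b01 eC.
have [y Fy yx] := H n; apply: (He y) => //.
apply: le_lt_trans yx _.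
rewrite ltr_pdivlMr in bn; last by rewrite ltr_pwDr.
apply: le_lt_trans bn; apply: ler_wpM2l; last by rewrite lerDl.
by apply: exprn_ge0; case/andP: b01.
Qed.

Definition affine_copy {R : realType} (K : set R) (l c : R) : set R :=
  [set l * x + c | x in K].

Lemma compact_affine_copy (R : realType) (K : set R) (l c : R) :
  compact K -> compact (affine_copy K l c).
Proof.
move=> cK; apply: continuous_compact => //.
apply: continuous_subspaceT => x.
by apply: cvgD; [apply: cvgM; [exact: cvg_cst|exact: cvg_id]|exact: cvg_cst].
Qed.

Lemma closed_affine_copy (R : realType) (K : set R) (l c : R) :
  compact K -> closed (affine_copy K l c).
Proof.
by move=> cK; apply: compact_closed; [exact: Rhausdorff|
  exact: compact_affine_copy].
Qed.

Section Cantor.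
Variables (R : realType) (N : nat) (beta : R) (Gamma : set R).
Hypothesis hN : (1 <= N)%N.
Hypothesis hbeta : calB N beta.
Hypothesis hGamma : is_attractor (phi_IFS N beta) Gamma.

(** * The Cantor set Gamma and its cylinders *)

Definition step : R := (1 - beta) / N%:R.

Lemma beta_gt0 : 0 < beta. Proof. by case: hbeta => /andP[]. Qed.

Lemma N_gt0 : 0 < N%:R :> R. Proof. by rewrite ltr0n. Qed.

Lemma beta_lt1 : beta < 1.
Proof.
case: hbeta => /andP[_ b1] _; apply: lt_le_trans b1 _.
by rewrite ler_pdivrMr ?ltr0n // mul1r ler1n.
Qed.

Lemma Nstep : N%:R * step = 1 - beta.
Proof. by rewrite /step mulrC divfK // gt_eqF // N_gt0. Qed.

Lemma beta_lt_step : beta < step.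
Proof.
rewrite /step ltr_pdivlMr ?N_gt0 //.
case: hbeta => /andP[_ b1] _.
by move: b1; rewrite ltr_pdivlMr ?ltr0n // -natr1; lra.
Qed.

Lemma step_gt0 : 0 < step.
Proof. exact: lt_trans beta_gt0 beta_lt_step. Qed.

Lemma digit_bounds (j : nat) : (j <= N)%N -> 0 <= j%:R * step <= 1 - beta.
Proof.
move=> jN; rewrite mulr_ge0 // ?(ltW step_gt0) //= -Nstep.
by rewrite ler_pM2r ?step_gt0 // ler_nat.
Qed.

Lemma digit_spacing (i j : nat) : (i < j)%N ->
  i%:R * step + step <= j%:R * step.
Proof.
move=> ij; have -> : i%:R * step + step = i.+1%:R * step.
  by rewrite -natr1; ring.
by rewrite ler_pM2r ?step_gt0 // ler_nat.
Qed.

Lemma bpow_gt0 n : 0 < beta ^+ n. Proof. by rewrite exprn_gt0 // beta_gt0. Qed.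

Lemma Gamma_cons (j : nat) z :
  (j <= N)%N -> Gamma z -> Gamma (beta * z + j%:R * step).
Proof.
move=> jN Gz; case: hGamma => _ _ ->.
by exists (phi N beta j); [exists j|exists z].
Qed.

Lemma Gamma_uncons x : Gamma x ->
  exists j z, [/\ (j <= N)%N, Gamma z & x = beta * z + j%:R * step].
Proof.
case: hGamma => _ _ {1}-> [f [j jN <-] [z Gz <-]].
by exists j, z.
Qed.

Lemma Gamma_closed : closed Gamma.
Proof.
case: hGamma => _ cG _; apply: compact_closed cG; exact: Rhausdorff.
Qed.

Lemma Gamma_compact : compact Gamma. Proof. by case: hGamma. Qed.

(** The excess of a bound on Gamma over [0, 1] shrinks by a factor beta each
time a point is written through one of the maps. *)
Lemma Gamma_01 x : Gamma x -> 0 <= x <= 1.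
Proof.
have [B HB] : exists B, forall y, Gamma y -> `|y| <= B.
  have /= [M [_ HM]] := compact_bounded Gamma_compact.
  exists (M + 1) => y Gy; apply: HM Gy; lra.
have B0 : 0 <= B.
  case: hGamma => -[y Gy] _ _; exact: le_trans (normr_ge0 _) (HB _ Gy).
have H n : forall x, Gamma x -> - (beta ^+ n * B) <= x <= 1 + beta ^+ n * B.
  elim: n => [|n IH] y Gy.
    by rewrite expr0 mul1r; move: (HB _ Gy); rewrite ler_norml; lra.
  have [j [z [jN Gz ->]]] := Gamma_uncons _ Gy.
  have /andP[z1 z2] := IH _ Gz.
  have /andP[j1 j2] := digit_bounds _ jN.
  have := ler_wpM2l (ltW beta_gt0) z1; have := ler_wpM2l (ltW beta_gt0) z2.
  by rewrite exprS; lra.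
move=> Gx.
have b01 : 0 <= beta < 1 by rewrite beta_lt1 (ltW beta_gt0).
apply/andP; split.
- apply: (closed_geometric_approx _ [set y : R | 0 <= y] _ _ B b01).
    exact: closed_ge.
  move=> n; have /andP[h1 h2] := H n _ Gx.
  exists (x + beta ^+ n * B) => /=; first lra.
  have := mulr_ge0 (ltW (bpow_gt0 n)) B0; set c := _ * _ => c0.
  by have -> : x + c - x = c; [ring|rewrite ger0_norm].
- apply: (closed_geometric_approx _ [set y : R | y <= 1] _ _ B b01).
    exact: closed_le.
  move=> n; have /andP[h1 h2] := H n _ Gx.
  exists (x - beta ^+ n * B) => /=; first lra.
  have := mulr_ge0 (ltW (bpow_gt0 n)) B0; set c := _ * _ => c0.
  by have -> : x - c - x = - c; [ring|rewrite normrN ger0_norm].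
Qed.

(** The left end of the cylinder of s, which is word_pt s + beta ^+ n * Gamma
where n, its level, is the size of s. *)
Fixpoint word_pt (s : seq nat) : R :=
  if s is j :: s' then beta * word_pt s' + j%:R * step else 0.

Definition word (s : seq nat) := all (fun j => (j <= N)%N) s.

Lemma Gamma_word s z : word s -> Gamma z ->
  Gamma (word_pt s + beta ^+ size s * z).
Proof.
elim: s => [|j s IH] /=; first by rewrite expr0 mul1r add0r.
move=> /andP[jN ws] Gz; rewrite exprS.
have -> : beta * word_pt s + j%:R * step + beta * beta ^+ size s * z =
  beta * (word_pt s + beta ^+ size s * z) + j%:R * step by ring.
by apply: Gamma_cons => //; exact: IH.
Qed.

Lemma Gamma_expand n x : Gamma x -> exists s z,
  [/\ word s, size s = n, Gamma z & x = word_pt s + beta ^+ n * z].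
Proof.
elim: n x => [|n IH] x Gx.
  by exists [::], x; split=> //=; rewrite expr0 mul1r add0r.
have [j [z [jN Gz ->]]] := Gamma_uncons _ Gx.
have [s [y [ws ss Gy ->]]] := IH _ Gz.
exists (j :: s), y; split => //=; first by rewrite jN.
- by rewrite ss.
- by rewrite exprS; ring.
Qed.

Lemma Gamma0 : Gamma 0.
Proof.
case: hGamma => -[x Gx] _ _.
apply: (closed_geometric_approx _ _ _ beta 1 _ Gamma_closed).
  by rewrite beta_lt1 (ltW beta_gt0).
move=> n; exists (beta ^+ n * x).
  elim: n => [|n IH]; first by rewrite expr0 mul1r.
  by rewrite exprS -mulrA -[_ * _]addr0 -(mul0r step); exact: (Gamma_cons 0).
have /andP[x0 x1] := Gamma_01 _ Gx.
rewrite subr0 ger0_norm ?mulr_ge0 ?(ltW (bpow_gt0 n)) //.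
by rewrite ler_wpM2l // ltW // bpow_gt0.
Qed.

Lemma word_pt_cat s s' :
  word_pt (s ++ s') = word_pt s + beta ^+ size s * word_pt s'.
Proof.
elim: s => [|j s IH] /=; first by rewrite expr0 mul1r add0r.
by rewrite IH exprS; ring.
Qed.

Lemma word_ptE s :
  word_pt s = step * \sum_(l < size s) (nth 0%N s l)%:R * beta ^+ l.
Proof.
elim: s => [|j s IH] /=; first by rewrite big_ord0 mulr0.
rewrite big_ord_recl /= IH expr0 mulr1 mulrDr mulrCA big_distrr /=.
rewrite addrC [step * _]mulrC; congr (_ + step * _).
by apply: eq_bigr => i _; rewrite /bump add1n exprS; ring.
Qed.

Lemma Gamma_word_pt s : word s -> Gamma (word_pt s).
Proof.
by move=> ws; have := Gamma_word s 0 ws Gamma0; rewrite mulr0 addr0.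
Qed.

Lemma word_pt_01 s : word s -> 0 <= word_pt s <= 1 - beta ^+ size s.
Proof.
elim: s => [|j s IH] /=; first by rewrite expr0 subrr lexx.
move=> /andP[jN ws]; have /andP[h0 h1] := IH ws.
have /andP[j0 j1] := digit_bounds _ jN.
have := ler_wpM2l (ltW beta_gt0) h0; have := ler_wpM2l (ltW beta_gt0) h1.
by rewrite exprS; lra.
Qed.

(** Reversing every digit j to N - j reverses the expansion of 1 - x. *)
Lemma Gamma_sym x : Gamma x -> Gamma (1 - x).
Proof.
move=> Gx.
apply: (closed_geometric_approx _ _ _ beta 1 _ Gamma_closed).
  by rewrite beta_lt1 (ltW beta_gt0).
move=> n; have [s [z [ws <- Gz ->]]] := Gamma_expand n _ Gx.
exists (word_pt [seq (N - j)%N | j <- s]).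
  apply: Gamma_word_pt; rewrite /word all_map; apply/allP => j _ /=.
  exact: leq_subr.
have -> : word_pt [seq (N - j)%N | j <- s] = 1 - beta ^+ size s - word_pt s.
  elim: s ws {Gz} => [|j s IH] /=; first by move=> _; rewrite expr0; ring.
  by move=> /andP[jN ws]; rewrite IH // exprS natrB // mulrBl Nstep; ring.
have /andP[z0 z1] := Gamma_01 _ Gz.
have -> : 1 - beta ^+ size s - word_pt s -
  (1 - (word_pt s + beta ^+ size s * z)) = - (beta ^+ size s * (1 - z)) by ring.
rewrite normrN ger0_norm ?mulr_ge0 ?subr_ge0 ?(ltW (bpow_gt0 _)) //.
by rewrite ler_wpM2l ?(ltW (bpow_gt0 _)) //; lra.
Qed.

Lemma Gamma1 : Gamma 1.
Proof. by rewrite -(subr0 1); exact: Gamma_sym Gamma0. Qed.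

(** Distinct first-level cylinders occupy disjoint intervals, as beta < step. *)
Lemma first_digit_inj (i j : nat) x y : 0 <= x <= 1 -> 0 <= y <= 1 ->
  beta * x + i%:R * step = beta * y + j%:R * step -> i = j.
Proof.
move=> /andP[x0 x1] /andP[y0 y1] e.
have b0 := beta_gt0; have bd := beta_lt_step.
have hx0 : 0 <= beta * x by rewrite mulr_ge0 // ltW.
have hx1 : beta * x <= beta by rewrite ler_piMr // ltW.
have hy0 : 0 <= beta * y by rewrite mulr_ge0 // ltW.
have hy1 : beta * y <= beta by rewrite ler_piMr // ltW.
case: (ltngtP i j) => // h; exfalso; have := digit_spacing _ _ h; lra.
Qed.

(** Disjointness of the hulls of first-level cylinders, iterated; it makes the
gaps of a cylinder gaps of Gamma. *)
Lemma Gamma_in_cylinder s y : word s -> Gamma y ->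
  word_pt s <= y <= word_pt s + beta ^+ size s ->
  exists2 z, Gamma z & y = word_pt s + beta ^+ size s * z.
Proof.
elim: s y => [|j s IH] y /=.
  by move=> _ Gy _; exists y => //; rewrite expr0 mul1r add0r.
move=> /andP[jN ws] Gy.
have [i [x [iN Gx ->]]] := Gamma_uncons _ Gy.
have b0 := beta_gt0.
rewrite exprS -(@ler_pM2l _ beta^-1) ?invr_gt0 // => /andP[y1 y2].
set w := (beta * x + i%:R * step - j%:R * step) / beta.
have wE : beta * w = beta * x + i%:R * step - j%:R * step.
  by rewrite /w mulrC divfK // gt_eqF.
have w1 : word_pt s <= w.
  by rewrite -(ler_pM2l b0) wE; move: y1; rewrite ler_pM2l ?invr_gt0 //; lra.
have w2 : w <= word_pt s + beta ^+ size s.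
  by rewrite -(ler_pM2l b0) wE; lra.
have /andP[p1 p2] := word_pt_01 _ ws.
have ij : i = j.
  apply: (first_digit_inj _ _ x w); first exact: Gamma_01.
    by apply/andP; split; lra.
  by rewrite wE; ring.
have wx : w = x.
  by apply: (mulfI (lt0r_neq0 b0)); rewrite wE ij; ring.
have [z Gz xE] : exists2 z, Gamma z & x = word_pt s + beta ^+ size s * z.
  by apply: IH => //; rewrite -wx w1 w2.
by exists z => //; rewrite {1}xE ij; ring.
Qed.

(** A common point determines the digits common to both words, by
first_digit_inj. *)
Lemma cylinders_meet_prefix s w x y : word s -> word w ->
  (size s <= size w)%N -> Gamma x -> Gamma y ->
  word_pt s + beta ^+ size s * x = word_pt w + beta ^+ size w * y ->
  take (size s) w = s.
Proof.
elim: s w => [|j s IH] [|i w] //=.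
move=> /andP[jN ws] /andP[iN ww] sw Gx Gy; rewrite !exprS => e.
have e' : beta * (word_pt s + beta ^+ size s * x) + j%:R * step =
   beta * (word_pt w + beta ^+ size w * y) + i%:R * step by lra.
have ji : j = i.
  by apply: first_digit_inj e'; apply: Gamma_01; exact: Gamma_word.
rewrite ji; congr (_ :: _); apply: IH => //.
apply: (mulfI (lt0r_neq0 beta_gt0)).
by move: e'; rewrite ji => /addIr.
Qed.

(** * Gaps of Gamma *)

Definition gap : R := step - beta.

Lemma gap_gt0 : 0 < gap. Proof. by rewrite subr_gt0 beta_lt_step. Qed.

(** Gamma has no gap longer than the first-level one: a point of [0, 1[ lies
in a first-level gap, or in the hull of a first-level cylinder, to which the
claim applies at scale beta. *)
Lemma Gamma_next y : 0 <= y < 1 -> exists2 x, Gamma x & y < x <= y + gap.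
Proof.
have H n : forall y, 0 <= y < 1 ->
    exists2 x, Gamma x & y < x <= y + Num.max (beta ^+ n) gap.
  elim: n => [|n IH] {}y /andP[y0 y1].
    exists 1; first exact: Gamma1.
    by rewrite y1 expr0; have : 1 <= Num.max 1 gap; [rewrite le_max lexx|lra].
  have d0 := step_gt0; have b0 := beta_gt0; have bd := beta_lt_step.
  have [i [iN i1 i2]] : exists i, [/\ (i <= N)%N, i%:R * step <= y &
      (i < N)%N -> y < i.+1%:R * step].
    elim: {-2}N (leqnn N) => [|k IHk] kN.
      by exists 0%N; rewrite mul0r.
    have [i [iN i1 i2]] := IHk (ltnW kN).
    case: (ltnP i k) => ik.
      by exists i; split => //; [exact: leqW|move=> _; exact: i2].
    have {iN ik} ik : i = k by lia.
    subst i; have [yk|ky] := ltP y (k.+1%:R * step).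
      by exists k.
    by exists k.+1; rewrite ltnn.
  have [yi|iy] := ltP y (i%:R * step + beta).
    have /IH [x Gx /andP[x1 x2]] : 0 <= (y - i%:R * step) / beta < 1.
      rewrite divr_ge0 ?(ltW b0) ?subr_ge0 //= ltr_pdivrMr // mul1r.
      by rewrite ltrBlDl.
    exists (beta * x + i%:R * step); first exact: Gamma_cons.
    move: x1; rewrite ltr_pdivrMr // => x1.
    have x2' : beta * x <= y - i%:R * step + beta * Num.max (beta ^+ n) gap.
      apply: le_trans (ler_wpM2l (ltW b0) x2) _.
      by rewrite mulrDr mulrCA divff ?mulr1 // gt_eqF.
    have : beta * Num.max (beta ^+ n) gap <= Num.max (beta ^+ n.+1) gap.
      rewrite exprS maxr_pMr ?(ltW b0) // ge_max !le_max lexx /=.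
      by rewrite ler_piMl ?orbT // ?(ltW gap_gt0) // ltW // beta_lt1.
    by move=> h; apply/andP; split; lra.
  have iN' : (i < N)%N.
    rewrite ltn_neqAle iN andbT; apply/eqP => iE.
    by move: iy; rewrite iE Nstep; lra.
  exists (i.+1%:R * step).
    by rewrite -[_ * _]add0r -(mulr0 beta); apply: Gamma_cons => //;
      exact: Gamma0.
  rewrite i2 //= -natr1.
  have : gap <= Num.max (beta ^+ n.+1) gap by rewrite le_max lexx orbT.
  rewrite /gap; lra.
have [n bn] := exists_expr_lt _ beta gap
  (introT andP (conj (ltW beta_gt0) beta_lt1)) gap_gt0.
by move=> /(H n); rewrite (max_r (ltW bn)).
Qed.

(** A copy of Gamma of ratio at most beta has only gaps shorter than the
first-level gaps, so inside Gamma it cannot cross one of them. *)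
Lemma small_copy_first_cylinder c mu : 0 < mu <= beta ->
  (forall x, Gamma x -> Gamma (mu * x + c)) ->
  exists i, (i <= N)%N /\
    forall x, Gamma x -> exists2 z, Gamma z & mu * x + c = beta * z + i%:R * step.
Proof.
move=> /andP[mu0 mub] H.
have Gc : Gamma c by have := H _ Gamma0; rewrite mulr0 add0r.
have [i [u [iN Gu cE]]] := Gamma_uncons _ Gc.
have b0 := beta_gt0; have bd := beta_lt_step.
have bz z : Gamma z -> 0 <= beta * z <= beta.
  move=> /Gamma_01/andP[z0 z1].
  by rewrite mulr_ge0 ?(ltW b0) //= ler_piMr // ltW.
exists i; split => // x Gx.
have [j [v [jN Gv xE]]] := Gamma_uncons _ (H _ Gx).
have [<-|ij] := eqVneq j i; first by exists v.
exfalso.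
have /andP[x0 x1] := Gamma_01 _ Gx.
have /andP[u0 u1] := bz _ Gu; have /andP[v0 v1] := bz _ Gv.
have mux0 : 0 <= mu * x by rewrite mulr_ge0 // ltW.
have ltij : (i < j)%N.
  by case: (ltngtP i j) ij => // h _; have := digit_spacing _ _ h; lra.
have dij := digit_spacing _ _ ltij.
(* y is the preimage of the right end of the cylinder i; the next point of Gamma
   after y is mapped into the gap on the right of that cylinder. *)
set y := (i%:R * step + beta - c) / mu.
have yE : mu * y = i%:R * step + beta - c.
  by rewrite /y mulrC divfK // gt_eqF.
have yx : y < x by rewrite -(ltr_pM2l mu0) yE; lra.
have y0 : 0 <= y by rewrite -(ler_pM2l mu0) yE mulr0; lra.
have [z Gz /andP[z1 z2]] : exists2 z, Gamma z & y < z <= y + gap.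
  by apply: Gamma_next; rewrite y0 (lt_le_trans yx x1).
move: z1 z2; rewrite -(ltr_pM2l mu0) -(ler_pM2l mu0) mulrDr yE => z1 z2.
have mug : mu * gap < gap.
  by rewrite gtr_pMl ?gap_gt0 // (le_lt_trans mub) // beta_lt1.
have [k [w [kN Gw wE]]] := Gamma_uncons _ (H _ Gz).
have /andP[w0 w1] := bz _ Gw.
move: mug; rewrite /gap => mug.
case: (ltngtP k i) => h; [have := digit_spacing _ _ h; lra| |
  by rewrite h in wE; lra].
have := digit_spacing _ _ h; rewrite /gap in z2; lra.
Qed.

(** Iterating small_copy_first_cylinder confines the copy to one cylinder of
level m, which has the same diameter as the copy. *)
Lemma copy_is_cylinder m c :
  (forall x, Gamma x -> Gamma (beta ^+ m * x + c)) ->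
  exists s, [/\ word s, size s = m & c = word_pt s].
Proof.
elim: m c => [|m IH] c H.
  exists [::]; split => //=.
  have := Gamma_01 _ (H _ Gamma0); have := Gamma_01 _ (H _ Gamma1).
  by rewrite expr0; lra.
have bm : 0 < beta ^+ m.+1 <= beta.
  rewrite bpow_gt0 exprS ler_piMr ?(ltW beta_gt0) //.
  by rewrite exprn_ile1 ?(ltW beta_gt0) // ltW // beta_lt1.
have [i [iN Hi]] := small_copy_first_cylinder _ _ bm H.
have b0 := lt0r_neq0 beta_gt0.
have [s [ws ss sE]] : exists s, [/\ word s, size s = m &
    (c - i%:R * step) / beta = word_pt s].
  apply: IH => x /Hi [z Gz e].
  suff -> : beta ^+ m * x + (c - i%:R * step) / beta = z by [].
  apply: (mulfI b0); rewrite mulrDr [beta * (_ / _)]mulrC divfK //.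
  by move: e; rewrite exprS; lra.
exists (i :: s); split => //=; first by rewrite iN.
- by rewrite ss.
- by rewrite -sE mulrC divfK // subrK.
Qed.

(** A gap either separates two consecutive first-level cylinders or lies in one
of them; rescaling the latter enlarges the gap, which cannot go on forever. *)
Lemma gap_length p q : Gamma p -> Gamma q -> p < q ->
  (forall r, Gamma r -> ~ (p < r < q)) -> exists n, q - p = gap * beta ^+ n.
Proof.
move=> Gp Gq pq H.
have [n bn] := exists_expr_lt _ beta (q - p)
  (introT andP (conj (ltW beta_gt0) beta_lt1)) ltac:(by rewrite subr_gt0).
elim: n p q Gp Gq pq H bn => [|n IH] p q Gp Gq pq H bn.
  have := Gamma_01 _ Gp; have := Gamma_01 _ Gq; rewrite expr0 in bn; lra.
have [i [u [iN Gu pE]]] := Gamma_uncons _ Gp.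
have [j [v [jN Gv qE]]] := Gamma_uncons _ Gq.
have b0 := beta_gt0; have bd := beta_lt_step.
have bz z : Gamma z -> 0 <= beta * z <= beta.
  move=> /Gamma_01/andP[z0 z1].
  by rewrite mulr_ge0 ?(ltW b0) //= ler_piMr // ltW.
have /andP[u0 u1] := bz _ Gu; have /andP[v0 v1] := bz _ Gv.
case: (ltngtP i j) => ij.
- have dij := digit_spacing _ _ ij.
  exists 0%N; rewrite expr0 mulr1.
  have G1 : Gamma (beta * 1 + i%:R * step) by apply: Gamma_cons; last exact: Gamma1.
  have G2 : Gamma (beta * 0 + i.+1%:R * step).
    by apply: Gamma_cons; [exact: leq_trans jN|exact: Gamma0].
  have pE' : p = beta * 1 + i%:R * step.
    apply/eqP; rewrite eq_le; apply/andP; split; first by lra.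
    rewrite leNgt; apply/negP => h; apply: (H _ G1); rewrite h; lra.
  have ij' : i.+1%:R * step <= j%:R * step by rewrite ler_pM2r ?step_gt0 // ler_nat.
  have qE' : q = beta * 0 + i.+1%:R * step.
    apply/eqP; rewrite eq_le; apply/andP; split; last by lra.
    rewrite leNgt; apply/negP => h; apply: (H _ G2); rewrite h andbT.
    by rewrite -natr1; lra.
  by rewrite pE' qE' /gap -natr1; ring.
- by have := digit_spacing _ _ ij; lra.
- have [|||k kE] := IH u v Gu Gv.
  + by rewrite -(ltr_pM2l b0); rewrite ij in pE; lra.
  + move=> r Gr /andP[r1 r2]; apply: (H (beta * r + i%:R * step)).
      exact: Gamma_cons.
    rewrite -(ltr_pM2l b0) in r1; rewrite -(ltr_pM2l b0) in r2.
    by rewrite ij in pE *; lra.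
  + by rewrite -(ltr_pM2l b0) -exprS; rewrite ij in pE; lra.
  exists k.+1; rewrite exprS mulrCA -kE.
  by rewrite ij in pE; lra.
Qed.

(** * Contraction ratios of copies of Gamma *)

Local Notation cyl s z := (word_pt s + beta ^+ size s * z).

(** Baire's theorem in Gamma for a finite closed cover: a cylinder that is not
inside the first set has a smaller cylinder that avoids it, on which the other
sets suffice. *)
Lemma cylinder_in_closed_piece (I : eqType) (T : seq I) (F : I -> set R) s :
  (forall i, closed (F i)) -> word s ->
  (forall z, Gamma z -> exists2 i, i \in T & F i (cyl s z)) ->
  exists i s', [/\ i \in T, word s' &
    forall z, Gamma z -> F i (cyl (s ++ s') z)].
Proof.
move=> cF; elim: T s => [|i T IH] s ws H.
  by have [] := H _ Gamma0.
have [Fi|/existsNP[z0 /not_implyP[Gz0 nF]]] :=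
    pselect (forall z, Gamma z -> F i (cyl s z)).
  by exists i, [::]; rewrite cats0 mem_head.
have [e e0 He] := closed_avoids_ball _ _ _ (cF i) nF.
have [n bn] := exists_expr_lt _ beta e
  (introT andP (conj (ltW beta_gt0) beta_lt1)) e0.
have [s1 [z1 [ws1 ss1 Gz1 z0E]]] := Gamma_expand n _ Gz0.
have wss : word (s ++ s1) by rewrite /word all_cat; apply/andP.
have cylE z : cyl (s ++ s1) z = cyl s (cyl s1 z).
  by rewrite word_pt_cat size_cat exprD; ring.
have [|j [s' [jT ws' Hj]]] := IH _ wss.
  move=> z Gz.
  have [j] := H (cyl s1 z) (Gamma_word _ _ ws1 Gz).
  rewrite -cylE inE => /orP[/eqP->|jT Fj]; last by exists j.
  move=> Fi; exfalso; apply: He Fi; apply: le_lt_trans bn.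
  have -> : cyl (s ++ s1) z - cyl s z0 =
      beta ^+ size s * (beta ^+ n * (z - z1)).
    by rewrite cylE z0E -ss1; ring.
  have /andP[p0 p1] := Gamma_01 _ Gz; have /andP[q0 q1] := Gamma_01 _ Gz1.
  rewrite !normrM !(ger0_norm (ltW (bpow_gt0 _))).
  have d1 : `|z - z1| <= 1 by rewrite ler_norml; apply/andP; split; lra.
  have bs1 : beta ^+ size s <= 1.
    by rewrite exprn_ile1 ?(ltW beta_gt0) // ltW // beta_lt1.
  have dn : beta ^+ n * `|z - z1| <= beta ^+ n.
    by rewrite ler_piMr // ltW // bpow_gt0.
  apply: le_trans dn; apply: ler_piMl => //.
  by rewrite mulr_ge0 // ltW // bpow_gt0.
exists j, (s1 ++ s'); split; first by rewrite inE jT orbT.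
- by rewrite /word all_cat; apply/andP.
- by move=> z; rewrite catA; exact: Hj.
Qed.

Lemma no_Gamma_in_first_gap z : Gamma z -> ~ (beta < z < step).
Proof.
move=> Gz; have [j [v [jN Gv ->]]] := Gamma_uncons _ Gz.
have b0 := beta_gt0; have /andP[v0 v1] := Gamma_01 _ Gv.
have h1 : 0 <= beta * v by rewrite mulr_ge0 // ltW.
have h2 : beta * v <= beta by rewrite ler_piMr // ltW.
case: j {jN} => [|j] /andP[]; first by rewrite mul0r; lra.
have : step <= j.+1%:R * step.
  by rewrite ler_peMl ?(ltW step_gt0) // ler1n.
lra.
Qed.

(** When a copy of Gamma inside Gamma contains a cylinder, the largest gap of
that cylinder is a gap of the copy, and the gaps of Gamma have lengths
gap * beta ^+ n. *)
Lemma ratio_is_power l c s : word s -> 0 < l < 1 ->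
  (forall x, Gamma x -> Gamma (l * x + c)) ->
  (forall z, Gamma z -> affine_copy Gamma l c (cyl s z)) ->
  exists m, l = beta ^+ m.
Proof.
move=> ws /andP[l0 l1] sub sup.
have Gb : Gamma beta.
  by have := Gamma_cons 0 1 isT Gamma1; rewrite mulr1 mul0r addr0.
have Gd : Gamma step.
  by have := Gamma_cons 1 0 hN Gamma0; rewrite mulr0 mul1r add0r.
have bs0 := bpow_gt0 (size s).
(* beta and step are the ends of the first gap of Gamma. *)
have [p Gp pE] := sup _ Gb; have [q Gq qE] := sup _ Gd.
have lpq : l * (q - p) = beta ^+ size s * gap.
  by rewrite /gap; move: pE qE; lra.
have pq : p < q.
  by rewrite -subr_gt0 -(pmulr_rgt0 _ l0) lpq mulr_gt0 // gap_gt0.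
have [|n nE] := gap_length _ _ Gp Gq pq.
  move=> r Gr /andP[pr rq].
  rewrite -(ltr_pM2l l0) in pr; rewrite -(ltr_pM2l l0) in rq.
  have b1 := beta_lt1; have b0 := beta_gt0.
  have h1 : 0 <= beta ^+ size s * beta by rewrite mulr_ge0 // ltW.
  have h2 : beta ^+ size s * step <= beta ^+ size s.
    rewrite ler_piMr ?(ltW bs0) //.
    by have := Gamma_01 _ Gd; case/andP.
  have [|z Gz zE] := Gamma_in_cylinder s (l * r + c) ws (sub _ Gr).
    by apply/andP; split; move: pE qE; lra.
  apply: (no_Gamma_in_first_gap _ Gz).
  by apply/andP; split; rewrite -(ltr_pM2l bs0); move: pE qE; lra.
have lE : l * beta ^+ n = beta ^+ size s.
  apply: (mulIf (lt0r_neq0 gap_gt0)); rewrite -lpq nE; ring.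
have [ns|sn] := leqP n (size s).
  exists (size s - n)%N; apply: (mulIf (lt0r_neq0 (bpow_gt0 n))).
  by rewrite lE -exprD subnK.
have : l * beta ^+ n < beta ^+ n by rewrite gtr_pMl // bpow_gt0.
rewrite lE ltNge ler_wiXn2l ?(ltW beta_gt0) ?(ltW beta_lt1) //.
exact: ltnW.
Qed.

(** * Arithmetic of words *)

Lemma word_pt_zeros n : word_pt (nseq n 0%N) = 0.
Proof. by elim: n => //= n ->; rewrite mul0r mulr0 addr0. Qed.

Lemma word_zeros n : word (nseq n 0%N).
Proof. by rewrite /word all_nseq orbT. Qed.

(** The least positive value of a word of size n is step * beta ^+ n.-1. *)
Lemma word_pt_lower_bound s : 0 < word_pt s ->
  step * beta ^+ size s <= beta * word_pt s.
Proof.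
have b0 := beta_gt0; have d0 := step_gt0.
elim: s => [|j s IH] /=; first by rewrite ltxx.
case: j => [|j] H.
  move: H; rewrite mul0r addr0 pmulr_rgt0 // => /IH h.
  by rewrite exprS mulrCA ler_pM2l.
have p0 : 0 <= word_pt s.
  elim: s {IH H} => [|i s IH] //=.
  by apply: addr_ge0; apply: mulr_ge0 => //; exact: ltW.
have bn : beta ^+ size s <= 1 by rewrite exprn_ile1 ?(ltW b0) // ltW // beta_lt1.
rewrite exprS mulrCA ler_pM2l //.
have h1 : step * beta ^+ size s <= step by rewrite ler_piMr // ltW.
have h2 : step <= j.+1%:R * step by rewrite ler_peMl ?(ltW d0) // ler1n.
have h3 : 0 <= beta * word_pt s by rewrite mulr_ge0 // ltW.
lra.
Qed.

(** This is where the digit condition defining calB enters: the sum of two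
words has digits at most 2 * N. *)
Lemma word_pt_add_digits a b c : word a -> word b -> word c ->
  size a = size c -> size b = size c -> word_pt c = word_pt a + word_pt b ->
  forall l, (l < size c)%N -> nth 0%N c l = (nth 0%N a l + nth 0%N b l)%N.
Proof.
move=> wa wb wc sa sb; rewrite !word_ptE sa sb -mulrDr -big_split /= => e l lc.
have e' := mulfI (lt0r_neq0 step_gt0) e.
case: hbeta => _ /(_ (size c)
  (fun k => inord (nth 0 a k + nth 0 b k)%N) (fun k => inord (nth 0%N c k))).
have na k : (k < size c)%N -> (nth 0%N a k <= N)%N.
  by rewrite -sa; apply: (all_nthP 0%N wa).
have nb k : (k < size c)%N -> (nth 0%N b k <= N)%N.
  by rewrite -sb; apply: (all_nthP 0%N wb).
have nc k : (k < size c)%N -> (nth 0%N c k <= N)%N.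
  exact: (all_nthP 0%N wc).
have nab k : (k < size c)%N -> (nth 0%N a k + nth 0%N b k < (2 * N).+1)%N.
  by move=> kc; have := na _ kc; have := nb _ kc; lia.
move=> /(_ (leq_ltn_trans (leq0n _) lc)) H.
have := H _ (Ordinal lc); rewrite !inordK ?nab ?ltnS ?nc //= => -> //.
transitivity (beta * \sum_(k < size c)
    ((nth 0%N a k)%:R * beta ^+ k + (nth 0%N b k)%:R * beta ^+ k)).
  rewrite big_distrr /=; apply: eq_bigr => k _.
  by rewrite inordK ?nab // natrD exprS; ring.
rewrite -e' big_distrr /=; apply: eq_bigr => k _.
by rewrite inordK ?ltnS ?nc // exprS; ring.
Qed.

(** If v had two non-zero digits, at positions p and q, a word made of
alternating blocks of 0 and N of length q - p would neither leave room for v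
nor dominate it; for a single digit i, the constant word i - 1 gives
i - 1 <= N - i. *)
Lemma single_nonzero_digit v n : word v -> 0 < word_pt v ->
  (forall w, word w -> size w = n ->
  exists2 k, (k + size v <= n)%N &
    (forall l, (l < size v)%N -> (nth 0 w (k + l) + nth 0 v l <= N)%N) \/
    (forall l, (l < size v)%N -> (nth 0 v l <= nth 0 w (k + l))%N)) ->
  exists p i, [/\ (p < size v)%N, (1 <= i <= N.+1 %/ 2)%N &
     word_pt v = i%:R * step * beta ^+ p].
Proof.
move=> wv v0 H.
have nv k : (k < size v)%N -> (nth 0%N v k <= N)%N.
  exact: (all_nthP 0%N wv).
have [p pv p0] : exists2 p, (p < size v)%N & (0 < nth 0%N v p)%N.
  apply: contrapT => nex; move: v0; rewrite word_ptE big1 ?mulr0 ?ltxx // => i _.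
  have [->|i0] := posnP (nth 0%N v i); first by rewrite mul0r.
  by case: nex; exists i.
have uniq_pos p1 p2 : (p1 < p2 < size v)%N ->
    (0 < nth 0%N v p1)%N -> (0 < nth 0%N v p2)%N -> False.
  move=> /andP[p12 p2v] n1 n2.
  have p1v := ltn_trans p12 p2v.
  pose d := (p2 - p1)%N; have d0 : (0 < d)%N by rewrite subn_gt0.
  pose f l := if odd (l %/ d) then N else 0%N.
  have [||k kn Hk] := H (mkseq f n).
  - by apply/allP => _ /mapP[l _ ->]; rewrite /f; case: ifP.
  - by rewrite size_mkseq.
  have fd : f (k + p2)%N = (N - f (k + p1))%N.
    have -> : (k + p2 = k + p1 + d)%N by rewrite /d; lia.
    rewrite /f divnDr // divnn d0 addn1 /=.
    by case: odd; rewrite /= ?subnn ?subn0.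
  have f0N l : f l = 0%N \/ f l = N by rewrite /f; case: ifP; [right|left].
  have := nv _ p1v; have := nv _ p2v.
  case: Hk => Hk; have := Hk _ p1v; have := Hk _ p2v;
    rewrite !nth_mkseq ?(leq_trans _ kn) ?ltn_add2l // fd;
    clear -n1 n2 f0N; case: (f0N (k + p1)%N) => ->; lia.
have vE : word_pt v = (nth 0%N v p)%:R * step * beta ^+ p.
  rewrite word_ptE (bigD1 (Ordinal pv)) //= big1 ?addr0; last first.
    move=> i ip; have [->|i0] := posnP (nth 0%N v i); first by rewrite mul0r.
    exfalso; case: (ltngtP i p) => [h|h|h].
    - by apply: (uniq_pos i p) => //; rewrite h.
    - by apply: (uniq_pos p i) => //; rewrite h ltn_ord.
    - by move/eqP: ip; apply; exact: val_inj.
  by rewrite mulrA [step * _]mulrC.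
exists p, (nth 0%N v p); split => //.
have [||k kn Hk] := H (nseq n (nth 0%N v p).-1).
- by rewrite /word all_nseq (leq_trans (leq_pred _)) ?orbT // nv.
- by rewrite size_nseq.
rewrite p0 /= leq_divRL // muln2 -addnn.
by case: Hk => /(_ _ pv); rewrite nth_nseq; case: ifP; lia.
Qed.

(** * Covers of the union by small copies of itself *)

Definition covers (A : set R) (S : seq (R * R)) :=
  (forall x, A x -> exists2 s, s \in S & affine_copy A s.1 s.2 x) /\
  (forall s, s \in S -> affine_copy A s.1 s.2 `<=` A).

(** Composing the maps of a cover with themselves gives covers of the same set,
with ratios tending to 0. *)
Lemma covers_small A S e : covers A S -> (forall s, s \in S -> 0 < s.1 < 1) ->
  0 < e -> exists2 S', covers A S' & forall s, s \in S' -> 0 < s.1 < e.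
Proof.
move=> [cS iS] S01 e0.
have [r /andP[r0 r1] Hr] : exists2 r : R, 0 < r < 1 &
    forall s, s \in S -> s.1 <= r.
  elim: S S01 {cS iS} => [|s S IH] H; first by exists (1 / 2) => //; lra.
  have [|r /andP[r0 r1] Hr] := IH; first by move=> u uS; apply: H; rewrite inE uS orbT.
  have /andP[s0 s1] := H _ (mem_head _ _).
  exists (Num.max r s.1); first by rewrite lt_max r0 gt_max r1 s1.
  move=> u; rewrite inE => /orP[/eqP->|/Hr ur]; first by rewrite le_max lexx orbT.
  by rewrite le_max ur.
have H n : exists2 S', covers A S' & forall s, s \in S' -> 0 < s.1 <= r ^+ n.
  elim: n => [|n [S' [cS' iS'] HS']].
    exists [:: (1, 0)]; last by move=> s; rewrite inE => /eqP->; rewrite /= ltr01 lexx.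
    split=> [x Ax|s].
      exists (1, 0); rewrite ?mem_head //; exists x => //=.
      by rewrite mul1r addr0.
    by rewrite inE => /eqP-> _ [x Ax <-] /=; rewrite mul1r addr0.
  exists [seq (s.1 * s'.1, s.1 * s'.2 + s.2) | s <- S, s' <- S'].
    split.
      move=> x /cS [s sS [y /cS' [s' s'S [z Az <-]] <-]].
      exists (s.1 * s'.1, s.1 * s'.2 + s.2); first by apply/allpairsP; exists (s, s').
      by exists z => //=; ring.
    move=> _ /allpairsP[[s s'] /= [sS s'S ->]] _ [z Az <-] /=.
    apply: (iS _ sS); exists (s'.1 * z + s'.2); last by ring.
    by apply: (iS' _ s'S); exists z.
  move=> _ /allpairsP[[s s'] /= [sS s'S ->]] /=.
  have /andP[s0 _] := S01 _ sS; have sr := Hr _ sS.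
  have /andP[s0' s1'] := HS' _ s'S.
  by rewrite mulr_gt0 //= exprS ler_pM // ltW.
have [n rn] := exists_expr_lt _ r e (introT andP (conj (ltW r0) r1)) e0.
have [S' cS' HS'] := H n; exists S' => // s /HS' /andP[-> h] /=.
exact: le_lt_trans rn.
Qed.

Lemma ratios_above_bpow (S : seq (R * R)) : (forall s, s \in S -> 0 < s.1) ->
  exists n0, forall n s, (n0 <= n)%N -> s \in S -> beta ^+ n <= s.1.
Proof.
elim: S => [|s S IH] H; first by exists 0%N.
have [|n0 Hn0] := IH; first by move=> u uS; apply: H; rewrite inE uS orbT.
have [n1 Hn1] := exists_expr_lt _ beta s.1
  (introT andP (conj (ltW beta_gt0) beta_lt1)) (H _ (mem_head _ _)).
exists (maxn n0 n1) => n u; rewrite geq_max => /andP[n0n n1n].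
rewrite inE => /orP[/eqP->|]; last exact: Hn0.
apply: le_trans (ltW Hn1).
by rewrite ler_wiXn2l ?(ltW beta_gt0) ?(ltW beta_lt1).
Qed.

Section Union.
Variable t : R.
Hypothesis t_gt0 : 0 < t.

Local Notation A := (Gamma `|` translate Gamma t).

Lemma union_bounds y : A y -> 0 <= y <= 1 + t.
Proof.
have t0 := t_gt0.
by case=> [/Gamma_01|[x /Gamma_01 + <-]] => /andP[h0 h1]; apply/andP; split; lra.
Qed.

Lemma union_sym y : A y -> A (1 + t - y).
Proof.
case=> [Gy|[x Gx <-]]; [right|left].
  by exists (1 - y); [exact: Gamma_sym|ring].
by have -> : 1 + t - (x + t) = 1 - x; [ring|exact: Gamma_sym].
Qed.

(** The symmetry of the union turns orientation-reversing maps into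
orientation-preserving ones with the same image. *)
Lemma self_similar_covers : self_similar_set A ->
  exists2 S, covers A S & forall s, s \in S -> 0 < s.1 < 1.
Proof.
case=> -[F [[finF simF] [_ _ AE]]] _.
have /finite_seqP [S0 S0E] :=
  finite_image (fun f : R -> R => (f 1 - f 0, f 0)) finF.
have S0P p : p \in S0 -> F (fun x => p.1 * x + p.2) /\ 0 < `|p.1| < 1.
  move=> pS; have : [set` S0] p by [].
  rewrite -S0E => -[f Ff <-] /=.
  have [l [a [l01 fE]]] := simF _ Ff.
  have e1 : f 1 - f 0 = l by rewrite fE; ring.
  have e0 : f 0 = a by rewrite fE; ring.
  by rewrite e1 e0 -fE.
have S0Q f : F f -> exists2 p, p \in S0 & f = fun x => p.1 * x + p.2.
  move=> Ff; have [l [a [l01 fE]]] := simF _ Ff.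
  exists (f 1 - f 0, f 0).
    have : [set (g 1 - g 0, g 0) | g in F] (f 1 - f 0, f 0) by exists f.
    by rewrite S0E.
  by rewrite /= fE; apply/funext => x; ring.
(* x |-> l * x + a and x |-> - l * x + (l * (1 + t) + a) differ by the
   reflection of A. *)
pose pos (p : R * R) := if 0 < p.1 then p else (- p.1, p.1 * (1 + t) + p.2).
exists [seq pos p | p <- S0].
  split.
    move=> x Ax.
    have [f /S0Q [p pS fE] [y Ay <-]] : (\bigcup_(f in F) (f @` A)) x by rewrite -AE.
    exists (pos p); first exact: map_f.
    rewrite /pos fE; case: ifP => _; first by exists y.
    by exists (1 + t - y); [exact: union_sym|rewrite /=; ring].
  move=> _ /mapP[p pS ->] _ [y Ay <-]; rewrite AE.
  have [Fp _] := S0P _ pS; exists (fun x => p.1 * x + p.2) => //.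
  rewrite /pos; case: ifP => _; first by exists y.
  by exists (1 + t - y); [exact: union_sym|rewrite /=; ring].
move=> _ /mapP[p pS ->]; have [_] := S0P _ pS; rewrite /pos.
case: ifPn => [p0|]; first by rewrite (ger0_norm (ltW p0)).
by rewrite -leNgt => p0; rewrite /= (ler0_norm p0).
Qed.

(** A cylinder covered by copies of the union that lie in Gamma: by Baire one
of these copies contains a smaller cylinder, so it has ratio beta ^+ m and
consists of two cylinders of level m. *)
Lemma cover_gives_cylinder_pair (S : seq (R * R)) w : word w ->
  (forall z, Gamma z -> exists2 s, s \in S & affine_copy A s.1 s.2 (cyl w z)) ->
  (forall s, s \in S -> beta ^+ size w <= s.1 < 1) ->
  (forall s z, s \in S -> Gamma z -> affine_copy A s.1 s.2 (cyl w z) ->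
     affine_copy A s.1 s.2 `<=` Gamma) ->
  exists s u u', [/\ s \in S, s.1 = beta ^+ size u, (size u <= size w)%N,
    word u /\ word u' &
    [/\ size u' = size u, word_pt u' = word_pt u + beta ^+ size u * t &
    take (size u) w = u \/ take (size u) w = u']].
Proof.
move=> ww cS S01 iS.
(* The images of the two halves of A, as copies of Gamma. *)
pose T := S ++ [seq (s.1, s.1 * t + s.2) | s <- S].
have [|z Gz|p [w' [pT ww' Hp]]] :=
  cylinder_in_closed_piece _ T (fun p => affine_copy Gamma p.1 p.2) w _ ww.
- by move=> p; apply: closed_affine_copy; exact: Gamma_compact.
- have [s sS [y Ay yE]] := cS _ Gz.
  case: Ay yE => [Gy|[x Gx <-]] yE.
    by exists s; [rewrite mem_cat sS|exists y].
  exists (s.1, s.1 * t + s.2).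
    by rewrite mem_cat; apply/orP; right; apply/mapP; exists s.
  by exists x => //; rewrite -yE /=; ring.
have [s [sS p1 p2]] : exists s, [/\ s \in S, p.1 = s.1 &
    p.2 = s.2 \/ p.2 = s.1 * t + s.2].
  move: pT; rewrite mem_cat => /orP[pS|/mapP[s sS ->]].
    by exists p; split => //; left.
  by exists s; split => //; right.
have pA : affine_copy Gamma p.1 p.2 `<=` affine_copy A s.1 s.2.
  move=> _ [x Gx <-]; rewrite p1; case: p2 => ->.
    by exists x => //; left.
  by exists (x + t); [right; exists x|ring].
have cylE z : cyl (w ++ w') z = cyl w (cyl w' z).
  by rewrite word_pt_cat size_cat exprD; ring.
have sG : affine_copy A s.1 s.2 `<=` Gamma.
  apply: (iS s (cyl w' 0) sS); first exact: Gamma_word Gamma0.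
  by rewrite -cylE; apply: pA; apply: Hp; exact: Gamma0.
have /andP[sw s1] := S01 _ sS.
have [m mE] : exists m, s.1 = beta ^+ m.
  apply: (ratio_is_power _ p.2 (w ++ w')).
  - by rewrite /word all_cat; apply/andP.
  - by rewrite s1 (lt_le_trans (bpow_gt0 _) sw).
  - by move=> x Gx; apply/sG/pA; rewrite p1; exists x.
  - by rewrite -p1.
have [u [wu su uE]] : exists u, [/\ word u, size u = m & s.2 = word_pt u].
  apply: copy_is_cylinder => x Gx; apply: sG; rewrite mE.
  by exists x => //; left.
have [u' [wu' su' uE']] :
    exists u, [/\ word u, size u = m & s.1 * t + s.2 = word_pt u].
  apply: copy_is_cylinder => x Gx; apply: sG; rewrite mE.
  by exists (x + t); [right; exists x|ring].
have mw : (m <= size w)%N.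
  by move: sw; rewrite mE ler_iXn2l // ?beta_gt0 // beta_lt1.
exists s, u, u'; rewrite su; split => //; split => //.
  by rewrite -uE' -uE mE addrC.
have [x Gx] := Hp _ Gamma0; rewrite cylE p1 => xE.
have Gy := Gamma_word _ _ ww' Gamma0.
case: p2 xE => ->; rewrite ?uE' ?uE mE => xE; [left|right].
  rewrite -su; apply: (cylinders_meet_prefix _ _ x) Gy _ => //; rewrite su //.
  by rewrite -xE addrC.
rewrite -su'; apply: (cylinders_meet_prefix _ _ x) Gy _ => //; rewrite su' //.
by rewrite -xE addrC.
Qed.

(** * Consequences for the digits of t *)

(** Near 0 the union is just Gamma, so a small copy of the union there sits in
Gamma; it starts at 0, and its second half at beta ^+ m * t, which is therefore
the left end of a cylinder of level m. *)
Lemma scaled_t_is_word_pt S : covers A S ->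
  (forall s, s \in S -> 0 < s.1 < 1) ->
  exists2 v, word v & word_pt v = beta ^+ size v * t.
Proof.
move=> cS S01; have t0 := t_gt0.
(* A has diameter 1 + t, so a copy of ratio below e that meets [0, t / 2[ stays
   on the left of t, and hence in Gamma. *)
pose e := t / (2 * (1 + t)).
have e0 : 0 < e by rewrite divr_gt0 // mulr_gt0 //; lra.
have eE : e * (1 + t) = t / 2 by rewrite /e; field; lra.
have e1 : e < 1.
  by rewrite /e ltr_pdivrMr ?mul1r; lra.
have [S' [cS' iS'] HS'] := covers_small _ _ _ cS S01 e0.
have [n0 Hn0] := ratios_above_bpow S' (fun s sS => proj1 (andP (HS' s sS))).
have [n1 Hn1] := exists_expr_lt _ beta (t / 2)
  (introT andP (conj (ltW beta_gt0) beta_lt1)) ltac:(lra).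
pose n := maxn n0 n1.
have bn : beta ^+ n < t / 2.
  apply: le_lt_trans Hn1; apply: ler_wiXn2l; rewrite ?(ltW beta_gt0) ?(ltW beta_lt1) //.
  exact: leq_maxr.
have [z Gz|s sS|s z sS Gz [y Ay yE] _ [y' Ay' <-]|] :=
  cover_gives_cylinder_pair S' (nseq n 0%N) (word_zeros n).
- by apply: cS'; left; apply: Gamma_word Gz; exact: word_zeros.
- rewrite size_nseq Hn0 ?leq_maxl //=.
  by have /andP[_ h] := HS' _ sS; exact: lt_trans h e1.
- have : A (s.1 * y' + s.2) by apply: (iS' _ sS); exists y'.
  case=> // -[x /Gamma_01/andP[x0 _] xE].
  move: yE; rewrite word_pt_zeros size_nseq add0r => yE.
  have /andP[s0 se] := HS' _ sS.
  have /andP[y0 y1] := union_bounds _ Ay; have /andP[y0' y1'] := union_bounds _ Ay'.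
  have /andP[z0 z1] := Gamma_01 _ Gz.
  have h1 : beta ^+ n * z <= beta ^+ n by rewrite ler_piMr // ltW // bpow_gt0.
  have h2 : 0 <= s.1 * y by rewrite mulr_ge0 // ltW.
  have h3 : s.1 * y' <= e * (1 + t) by rewrite ler_pM // ltW.
  by exfalso; lra.
move=> s [u [u' [sS sE un [wu wu'] [su uE pre]]]].
have take0 : take (size u) (nseq n 0%N) = nseq (size u) 0%N.
  by rewrite take_nseq //; move: un; rewrite size_nseq.
have bt0 : 0 < beta ^+ size u * t by rewrite mulr_gt0 // bpow_gt0.
exists u' => //; rewrite uE su.
case: pre; rewrite take0 => e0u.
  by rewrite -{1}e0u word_pt_zeros add0r.
have /andP[p0 _] := word_pt_01 _ wu.
by move: uE; rewrite -e0u word_pt_zeros; lra.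
Qed.

Lemma t_gt1 v : word_pt v = beta ^+ size v * t -> 1 < t.
Proof.
move=> vE; have b0 := beta_gt0; have bn := bpow_gt0 (size v).
have /word_pt_lower_bound : 0 < word_pt v by rewrite vE mulr_gt0 // t_gt0.
rewrite vE mulrCA mulrC ler_pM2l // => h.
by rewrite -(ltr_pM2l b0) mulr1; exact: lt_le_trans beta_lt_step h.
Qed.

(** Digit form of the self-similarity of the union. Once t > 1, small copies
of the union meeting Gamma lie in Gamma; each is a pair of cylinders u, u' where
u' is u plus the digits v of t, without carry. A long word w
starts with u or with u', so near some position its digits leave room for v or
dominate v. *)
Lemma words_compare_with_t S v : covers A S ->
  (forall s, s \in S -> 0 < s.1 < 1) ->
  word v -> word_pt v = beta ^+ size v * t ->
  exists n, forall w, word w -> size w = n ->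
  exists2 k, (k + size v <= n)%N &
    (forall l, (l < size v)%N -> (nth 0 w (k + l) + nth 0 v l <= N)%N) \/
    (forall l, (l < size v)%N -> (nth 0 v l <= nth 0 w (k + l))%N).
Proof.
move=> cS S01 wv vE; have t0 := t_gt0; have t1 := t_gt1 _ vE.
(* The first bound leaves room for the digits of v in words of the level of the
   copy; the second makes the copy shorter than the gap between 1 and t. *)
pose e := Num.min (beta ^+ size v) ((t - 1) / (1 + t)).
have e0 : 0 < e by rewrite lt_min bpow_gt0 divr_gt0 //; lra.
have eE : e * (1 + t) <= t - 1.
  by rewrite -ler_pdivlMr ?ge_min ?lexx ?orbT //; lra.
have e1 : e <= 1.
  by rewrite ge_min exprn_ile1 ?(ltW beta_gt0) // ltW // beta_lt1.
have [S' [cS' iS'] HS'] := covers_small _ _ _ cS S01 e0.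
have [n Hn] := ratios_above_bpow S' (fun s sS => proj1 (andP (HS' s sS))).
exists n => w ww wn.
have [z Gz|s sS|s z sS Gz [y Ay yE] _ [y' Ay' <-]|] :=
  cover_gives_cylinder_pair S' w ww.
- by apply: cS'; left; exact: Gamma_word.
- rewrite wn Hn //=.
  by have /andP[_ h] := HS' _ sS; exact: lt_le_trans h e1.
- have : A (s.1 * y' + s.2) by apply: (iS' _ sS); exists y'.
  case=> // -[x /Gamma_01/andP[x0 _] xE].
  have /andP[s0 se] := HS' _ sS.
  have /andP[y0 y1] := union_bounds _ Ay; have /andP[y0' y1'] := union_bounds _ Ay'.
  have /andP[_ z1] := Gamma_01 _ (Gamma_word _ _ ww Gz).
  have h2 : 0 <= s.1 * y by rewrite mulr_ge0 // ltW.
  have h3 : s.1 * y' < e * (1 + t).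
    by apply: (@le_lt_trans _ _ (s.1 * (1 + t)));
       [rewrite ler_pM2l|rewrite ltr_pM2r //; lra].
  by exfalso; lra.
move=> s [u [u' [sS sE un [wu wu'] [su uE pre]]]].
have vu : (size v <= size u)%N.
  have /andP[_ se] := HS' _ sS.
  have : beta ^+ size u < beta ^+ size v.
    by rewrite -sE; apply: lt_le_trans se _; rewrite ge_min lexx.
  by rewrite ltr_iXn2l ?beta_gt0 ?beta_lt1 // => /ltnW.
(* Padding v with zeros turns beta ^+ size u * t into a word of the size of u. *)
pose k := (size u - size v)%N; pose v' := nseq k 0%N ++ v.
have kv : (k + size v)%N = size u by rewrite subnK.
have sv' : size v' = size u by rewrite size_cat size_nseq subnK.
have dig l : (l < size v)%N ->
    nth 0%N u' (k + l) = (nth 0%N u (k + l) + nth 0%N v l)%N.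
  move=> lv; have -> : nth 0%N v l = nth 0%N v' (k + l).
    by rewrite nth_cat size_nseq ltnNge leq_addr /= addKn.
  apply: word_pt_add_digits => //; rewrite ?sv' ?su //.
  - by rewrite /word all_cat; apply/andP; split => //; exact: word_zeros.
  - rewrite uE word_pt_cat word_pt_zeros size_nseq add0r vE mulrA -exprD.
    by rewrite subnK.
  - by rewrite -kv ltn_add2l.
have nw l : (l < size v)%N -> nth 0%N (take (size u) w) (k + l) = nth 0%N w (k + l).
  by move=> lv; rewrite nth_take // -kv ltn_add2l.
exists k; first by rewrite subnK // -wn.
case: pre => e'; [left|right] => l lv; rewrite -nw // e'.
- by rewrite -dig //; apply: (all_nthP 0%N wu'); rewrite su -kv ltn_add2l.
- by rewrite dig // leq_addl.
Qed.

(** * The converse *)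

Lemma Gamma_offsets k : exists E : seq R,
  forall x, Gamma x <-> exists2 e, e \in E & affine_copy Gamma (beta ^+ k) e x.
Proof.
elim: k => [|k [E HE]].
  exists [:: 0] => x; split=> [Gx|[e]].
    by exists 0; rewrite ?mem_head //; exists x; rewrite ?mul1r ?addr0.
  by rewrite inE => /eqP-> [y Gy <-]; rewrite mul1r addr0.
exists [seq beta * e + j%:R * step | e <- E, j <- iota 0 N.+1] => x; split.
  move=> /Gamma_uncons[j [z [jN /HE [e eE [y Gy <-]] ->]]].
  exists (beta * e + j%:R * step).
    by apply/allpairsP; exists (e, j); rewrite mem_iota.
  by exists y => //; rewrite exprS; ring.
move=> [_ /allpairsP[[e j] [eE + ->]] [y Gy <-]].
rewrite mem_iota /= => jN.
have -> : beta ^+ k.+1 * y + (beta * e + j%:R * step) =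
  beta * (beta ^+ k * y + e) + j%:R * step by rewrite exprS; ring.
by apply: Gamma_cons => //; apply/HE; exists e => //; exists y.
Qed.

(** With beta ^+ k.+1 * t = i * step, the scaled union is a pair of cylinders
whose first digits differ by i. As 2 * i <= N + 1, such pairs of digits cover
{0, .., N}, so scaled unions tile Gamma, and likewise Gamma + t. *)
Lemma union_self_similar i k : (1 <= i <= N.+1 %/ 2)%N ->
  beta ^+ k.+1 * t = i%:R * step -> self_similar_set A.
Proof.
rewrite leq_divRL // muln2 -addnn => /andP[i1 iN] tE.
have [E HE] := Gamma_offsets k.
pose L := [seq beta * e + j%:R * step | e <- E, j <- iota 0 (N - i).+1].
have LP x : x \in L -> exists e j, [/\ e \in E, (j + i <= N)%N &
    x = beta * e + j%:R * step].
  case/allpairsP => -[e j] [eE + ->]; rewrite mem_iota /= => jN.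
  by exists e, j; split => //; lia.
have PL e j : e \in E -> (j + i <= N)%N -> beta * e + j%:R * step \in L.
  by move=> eE jN; apply/allpairsP; exists (e, j); rewrite mem_iota /=; split => //; lia.
have tile x : Gamma x -> exists2 e, e \in L & affine_copy A (beta ^+ k.+1) e x.
  move=> /Gamma_uncons[j [z [jN /HE [e eE [y Gy <-]] ->]]].
  have [ji|ij] := leqP (j + i) N.
    exists (beta * e + j%:R * step); first exact: PL.
    by exists y; [left|rewrite exprS; ring].
  have ij' : (i <= j)%N by lia.
  exists (beta * e + (j - i)%:R * step); first by apply: PL => //; rewrite subnK.
  exists (y + t); first by right; exists y.
  by rewrite natrB // mulrDr tE exprS; ring.
have inG e : e \in L -> affine_copy A (beta ^+ k.+1) e `<=` Gamma.
  move=> /LP [e' [j [eE jN ->]]] _ [y Ay <-].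
  have G z : Gamma z -> Gamma (beta ^+ k * z + e').
    by move=> Gz; apply/HE; exists e' => //; exists z.
  case: Ay => [Gy|[x Gx <-]].
    have -> : beta ^+ k.+1 * y + (beta * e' + j%:R * step) =
      beta * (beta ^+ k * y + e') + j%:R * step by rewrite exprS; ring.
    by apply: Gamma_cons; [exact: leq_trans (leq_addr _ _) jN|exact: G].
  rewrite mulrDr tE; have -> : beta ^+ k.+1 * x + i%:R * step +
    (beta * e' + j%:R * step) = beta * (beta ^+ k * x + e') + (j + i)%:R * step.
    by rewrite exprS natrD; ring.
  by apply: Gamma_cons => //; exact: G.
split; last first.
  move=> [x Ax]; have : A 0 by left; exact: Gamma0.
  have : A t by right; exists 0; [exact: Gamma0|rewrite add0r].
  rewrite Ax /= => tx x0; have := t_gt0; lra.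
exists [set (fun x => beta ^+ k.+1 * x + e) | e in [set` L ++ [seq e + t | e <- L]]].
split; [split|split].
- by apply: finite_image; exact: finite_seq.
- move=> _ [e _ <-]; exists (beta ^+ k.+1), e; split => //.
  rewrite gtr0_norm ?bpow_gt0 //= exprn_ilt1 ?(ltW beta_gt0) //.
  exact: beta_lt1.
- by exists 0; left; exact: Gamma0.
- apply: compactU; first exact: Gamma_compact.
  have -> : translate Gamma t = affine_copy Gamma 1 t.
    by apply/seteqP; split => _ [x Gx <-]; exists x; rewrite ?mul1r.
  by apply: compact_affine_copy; exact: Gamma_compact.
- apply/seteqP; split => x.
    case=> [/tile[e eL [y Ay <-]]|[_ /tile[e eL [y Ay <-]] <-]].
      exists (fun x => beta ^+ k.+1 * x + e); last by exists y.
      by exists e => //=; rewrite mem_cat eL.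
    exists (fun x => beta ^+ k.+1 * x + (e + t)); last by exists y => //; ring.
    exists (e + t) => //=.
    by rewrite mem_cat; apply/orP; right; apply/mapP; exists e.
  move=> [_ [e /= + <-]] [y Ay <-]; rewrite mem_cat => /orP[eL|/mapP[e' eL ->]].
    by left; apply: (inG _ eL); exists y.
  right; exists (beta ^+ k.+1 * y + e'); last by ring.
  by apply: (inG _ eL); exists y.
Qed.

End Union.
End Cantor.

Theorem corollary1p6 (R : realType) (N : nat) (beta : R) (Gamma : set R) (t : R)
    (hN : (1 <= N)%N) (hbeta : calB N beta)
    (hGamma : is_attractor (phi_IFS N beta) Gamma) (ht : 0 < t) :
  self_similar_set (Gamma `|` translate Gamma t) <->
  exists i k : nat,
    [/\ (1 <= i <= N.+1 %/ 2)%N, (1 <= k)%N &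
        t = i%:R * (1 - beta) / N%:R * beta ^- k].
Proof.
have b0 := beta_gt0 _ _ _ hbeta.
split=> [/(self_similar_covers _ _ _ _ hN hbeta hGamma)[S cS S01]|].
  have [v wv vE] :=
    scaled_t_is_word_pt _ _ _ _ hN hbeta hGamma _ ht S cS S01.
  have [n Hn] :=
    words_compare_with_t _ _ _ _ hN hbeta hGamma _ ht S v cS S01 wv vE.
  have v0 : 0 < word_pt R N beta v by rewrite vE mulr_gt0 // exprn_gt0.
  have [p [i [pv iN pE]]] := single_nonzero_digit _ _ _ hN v n wv v0 Hn.
  exists i, (size v - p)%N; split => //; first by rewrite subn_gt0.
  apply: (mulfI (lt0r_neq0 (exprn_gt0 (size v) b0))).
  have sE : beta ^+ size v = beta ^+ (size v - p) * beta ^+ p.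
    by rewrite -exprD subnK // ltnW.
  rewrite -vE pE sE /step.
  have bn : beta ^+ (size v - p) != 0 by rewrite lt0r_neq0 // exprn_gt0.
  have n0 : N%:R != 0 :> R by rewrite pnatr_eq0 -lt0n.
  by field; rewrite bn n0.
case=> i [[|k] [iN //_ tE]].
apply: (union_self_similar _ _ _ _ hN hbeta hGamma _ ht i k) => //.
by rewrite tE mulrC divfK ?lt0r_neq0 ?exprn_gt0 // /step mulrA.
Qed.
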